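(* Let $z\in(0,1-1/\sqrt2)$, let $\tau,\gamma$ be positive numbers and let $\{\Delta_m,\ m\in\mathcal M\}$ be nonnegative numbers such that $\Sigma=\sum_{m\in\mathcal M}e^{-\Delta_m}<+\infty$ and $\Delta_m\ge 1$ for all $m$. Assume that there are positive numbers $\{d_m,\ m\in\mathcal M\}$ such that for all $(m,m')\in\mathcal M^2$, all $\xi>0$ and all $y>0$ with $y^2\ge\tau(d_m\vee d_{m'}+\xi)$, $$\mathbb P\left[\sup_{(t,t')\in S_m\times S_{m'}}\frac{Z(N,t,t')}{w^2(t,t',y)}\ge z\right]\le\gamma e^{-\xi}.$$ Let $\mathrm{pen}:\mathbb S\to\mathbb R_+$ satisfy $$\mathrm{pen}(t)\ge z\tau\inf\{d_m+\Delta_m,\ m\in\mathcal M(t)\}\quad\text{for all }t\in\mathbb S,\qquad( * )$$ and let $\tilde s=\hat s_{\hat\lambda}$ be selected among $\{\hat s_\lambda,\lambda\in\Lambda\}$ by the selection procedure described in the context. Then there exists a constant $C>0$ depending on $z$ only such that $$C\,\mathbb E[H^2(s,\tilde s)]\le\mathbb E\left[\inf_{\lambda\in\Lambda}\{H^2(s,\hat s_\lambda)+\mathrm{pen}(\hat s_\lambda)\}\right]+\tau[(\gamma\Sigma^2)\vee1]\le\inf_{\lambda\in\Lambda}\mathbb E\left[H^2(s,\hat s_\lambda)+\mathrm{pen}(\hat s_\lambda)\right]+\tau[(\gamma\Sigma^2)\vee1].$$ In particular, if equality holds in $( * )$, then $$\mathbb E[H^2(s,\tilde s)]\le C'\inf_{\lambda\in\Lambda}\left\{\mathbb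 E[H^2(s,\hat s_\lambda)]+\mathbb E[v^2(\hat s_\lambda)]\right\},$$ where for all $\lambda\in\Lambda$ $$v^2(\hat s_\lambda)=\tau\inf_{m\in\mathcal M(\hat s_\lambda)}(d_m\vee\Delta_m)\le\tau\left(d_{\hat m(\lambda)}\vee\Delta_{\hat m(\lambda)}\right)$$ and $C'$ is a constant depending on $z,\gamma$ and $\Sigma$.
   Context: Setting. $N_1,\dots,N_k$ are independent random measures on a probability space $(\Omega,\mathcal T,\mathbb P)$, $N_i$ taking values in the positive measures on a measured space $(\mathcal X_i,\mathcal A_i,\mu_i)$, with $\mathbb E[N_i(A)]=\int_A s_i\,d\mu_i<+\infty$ for all $A\in\mathcal A_i$, where $s_i\ge0$ is measurable. Write $N=(N_1,\dots,N_k)$, $s=(s_1,\dots,s_k)$, $\mu=(\mu_1,\dots,\mu_k)$. $\mathcal L$ is the set of $k$-tuples $t=(t_1,\dots,t_k)$ of nonnegative measurable functions with $t_i$ integrable on $(\mathcal X_i,\mathcal A_i,\mu_i)$; $\mathcal L_0\subset\mathcal L$ is a known subset containing $s$. All operations on $k$-tuples are componentwise, and $\int_{\mathcal X}f\,d\nu=\sum_{i=1}^k\int_{\mathcal X_i}f_i\,d\nu_i$. The loss is $H^2(t,t')=\frac12\int_{\mathcal X}(\sqrt t-\sqrt{t'})^2d\mu$. Notation. $\rho(t,t')=\int_{\mathcal X}\sqrt{tt'}\,d\mu$, $\rho_r(\nu,t)=\frac12\left[\rho(t,r)+\int_{\mathcal X}\sqrt{t/r}\,d\nu\right]$ (conventions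 $0/0=0$, $a/0=+\infty$ for $a>0$). $Z(N,t,t')=\int_{\mathcal X}\psi(t,t',x)\,dN-\int_{\mathcal X}\psi(t,t',x)\,s\,d\mu$, where (componentwise) $\psi(t,t',x)=\frac1{\sqrt2}\left[\sqrt{\frac1{1+t(x)/t'(x)}}-\sqrt{\frac1{1+t'(x)/t(x)}}\right]$. For $y>0$, $w^2(t,t',y)=[H^2(s,t)+H^2(s,t')]\vee y^2$. Models and estimators. $\{S_m,\ m\in\mathcal M\}$ is an at most countable family of nonvoid subsets of $\mathcal L_0$, $\mathbb S=\bigcup_{m}S_m$, $\mathcal M(t)=\{m\in\mathcal M:\ t\in S_m\}$ for $t\in\mathbb S$. $\{\hat s_\lambda,\lambda\in\Lambda\}$ is an at most countable family of estimators (measurable functions of $N$) with values in $\mathbb S$; $\hat m(\lambda)$ is a (possibly random, depending on $N$) element of $\mathcal M(\hat s_\lambda)$. Selection procedure. For $\hat s_\lambda\ne\hat s_{\lambda'}$ put, with $r=(\hat s_\lambda+\hat s_{\lambda'})/2$, $$\mathbf T(N,\hat s_\lambda,\hat s_{\lambda'})=\left[\rho_r(N,\hat s_{\lambda'})-\tfrac12\int_{\mathcal X}\hat s_{\lambda'}d\mu-\mathrm{pen}(\hat s_{\lambda'})\right]-\left[\rho_r(N,\hat s_\lambda)-\tfrac12\int_{\mathcal X}\hat s_\lambda d\mu-\mathrm{pen}(\hat s_\lambda)\right].$$ Let $\mathcal E(\hat s_\lambda)$ be the set of those $\hat s_{\lambda'}\neq\hat s_\lambda$ with $\mathbf T(N,\hat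 s_\lambda,\hat s_{\lambda'})\ge0$, and $\mathcal D(\hat s_\lambda)=\sup\{H^2(\hat s_\lambda,\hat s_{\lambda'}):\hat s_{\lambda'}\in\mathcal E(\hat s_\lambda)\}$ if $\mathcal E(\hat s_\lambda)\ne\varnothing$, $\mathcal D(\hat s_\lambda)=0$ otherwise. Then $\hat\lambda$ is any element of $\Lambda$ such that $\mathcal D(\hat s_{\hat\lambda})\le\mathcal D(\hat s_\lambda)+\tau$ for all $\lambda\in\Lambda$. *)

(* Defs.v *)
From HB Require Import structures.
From mathcomp Require Import all_boot all_order all_algebra.
From mathcomp Require Import all_classical all_reals all_analysis measurable_realfun.

Set Implicit Arguments.
Unset Strict Implicit.
Unset Printing Implicit Defensive.
Import Order.TTheory GRing.Theory Num.Theory.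

Local Open Scope classical_set_scope.
Local Open Scope ring_scope.
Local Open Scope ereal_scope.

Section Tuples.
Context {R : realType} {k : nat} {d : 'I_k -> measure_display}
  {X : forall i, measurableType (d i)}.

Definition ktuple := forall i : 'I_k, X i -> R.

Definition mtuple := forall i : 'I_k, {measure set X i -> \bar R}.

Implicit Types (mu nu : mtuple) (s t r : ktuple).

Definition calL mu : set ktuple := [set t : ktuple | forall i,
  [/\ forall x, (0 <= t i x)%R,
      measurable_fun [set: X i] (t i)
    & (mu i).-integrable [set: X i] (EFin \o t i)]].

Definition integ nu (f : forall i, X i -> \bar R) : \bar R :=
  \sum_(i < k) \int[nu i]_x f i x.

Definition hell2 mu t t' : \bar R :=
  (2^-1)%:E *
  integ mu (fun i x => ((Num.sqrt (t i x) - Num.sqrt (t' i x)) ^+ 2)%:E).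

Definition rho mu t t' : \bar R :=
  integ mu (fun i x => (Num.sqrt (t i x * t' i x))%:E).

(* Quotients are taken in \bar R, where 0 / 0 = 0 * +oo = 0 and a / 0 = +oo for
   a > 0, which are the conventions wanted here (they fail for the division
   of R). *)
Definition rho_r mu nu r t : \bar R :=
  (2^-1)%:E *
  (rho mu t r + integ nu (fun i x => sqrte ((t i x)%:E / (r i x)%:E))).

Definition psi (a b : R) : \bar R :=
  ((Num.sqrt 2)^-1)%:E *
  (sqrte (1 / (1 + a%:E / b%:E)) - sqrte (1 / (1 + b%:E / a%:E))).

Definition Zproc mu s nu t t' : \bar R :=
  integ nu (fun i x => psi (t i x) (t' i x)) -
  integ mu (fun i x => psi (t i x) (t' i x) * (s i x)%:E).

Definition w2 mu s t t' (y : R) : \bar R :=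
  maxe (hell2 mu s t + hell2 mu s t') (y ^+ 2)%:E.

Definition midpoint t t' : ktuple := fun i x => ((t i x + t' i x) / 2)%R.

Definition crit mu (pen : ktuple -> R) nu r t : \bar R :=
  rho_r mu nu r t - (2^-1)%:E * integ mu (fun i x => (t i x)%:E) - (pen t)%:E.

Definition Ttest mu pen nu t t' : \bar R :=
  let r := midpoint t t' in crit mu pen nu r t' - crit mu pen nu r t.

(* F is the (observed) family of estimators among which one selects. *)
Definition calE mu pen nu (F : set ktuple) t : set ktuple :=
  [set t' | [/\ F t', t' <> t & 0 <= Ttest mu pen nu t t']].

Definition calD mu pen nu (F : set ktuple) t : \bar R :=
  if calE mu pen nu F t == set0 then 0
  else ereal_sup [set hell2 mu t t' | t' in calE mu pen nu F t].

End Tuples.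
Arguments ktuple R {k d} X.
Arguments mtuple R {k d} X.

Section RandomMeasures.
Context {R : realType} {k : nat} {d : 'I_k -> measure_display}
  {X : forall i, measurableType (d i)}
  {d0 : measure_display} {Omega : measurableType d0}.

(* A kernel from Omega to X i is exactly a random measure: a map w |-> N i w
   such that w |-> N i w A is measurable for every measurable A. *)
Definition randmeas := forall i : 'I_k, R.-ker Omega ~> X i.

Definition obs (N : randmeas) (w : Omega) : mtuple R X := fun i => N i w.

Definition eval_events (N : randmeas) (i : 'I_k) : set (set Omega) :=
  [set E | exists2 A : set (X i), measurable A &
           exists2 B : set (\bar R), measurable B &
             E = (fun w => N i w A) @^-1` B].

Definition sigma_coord (N : randmeas) (i : 'I_k) : set (set Omega) :=
  <<s eval_events N i >>.

Definition sigma_obs (N : randmeas) : set (set Omega) :=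
  <<s \bigcup_(i in [set: 'I_k]) eval_events N i >>.

Definition independent_randmeas (P : probability Omega R) (N : randmeas) :=
  forall (J : {set 'I_k}) (E : 'I_k -> set Omega),
    (forall i, sigma_coord N i (E i)) ->
    P (\bigcap_(i in [set i | i \in J]) E i) = \prod_(i in J) P (E i).

(* est is sigma(N)-measurable, the set of k-tuples being equipped with the
   smallest sigma-algebra for which all the maps hell2 t, t in calL, are
   measurable.  It is contained in the Borel sigma-algebra of the
   pseudo-distance sqrt hell2, so that this is the weakest requirement on an
   estimator for which its losses are random variables. *)
Definition estimator (mu : mtuple R X) (N : randmeas)
    (est : Omega -> ktuple R X) :=
  forall t, calL mu t -> forall B : set (\bar R), measurable B ->
    sigma_obs N ((fun w => hell2 mu t (est w)) @^-1` B).

End RandomMeasures.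
Arguments randmeas R {k d} X {d0} Omega.

Section Models.
Context {R : realType} {k : nat} {d : 'I_k -> measure_display}
  {X : forall i, measurableType (d i)} {M : countType}.
Variable S : M -> set (ktuple R X).

Definition bbS : set (ktuple R X) := \bigcup_(m in [set: M]) S m.

Definition calM (t : ktuple R X) : set M := [set m | S m t].

Definition pen_bound (z tau : R) (dm Delta : M -> R) (t : ktuple R X) : R :=
  (z * tau * inf [set dm m + Delta m | m in calM t])%R.

Definition v2 (tau : R) (dm Delta : M -> R) (t : ktuple R X) : R :=
  (tau * inf [set Num.max (dm m) (Delta m) | m in calM t])%R.

(* The supremum runs over a possibly uncountable set and
   need not be measurable; mu_ext P is the outer measure of P, which agrees with
   P on measurable sets. *)
Definition deviation_bound {d0 : measure_display} {Omega : measurableType d0}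
    (P : probability Omega R) (mu : mtuple R X) (s : ktuple R X)
    (N : randmeas R X Omega) (z tau gamma : R) (dm : M -> R) :=
  forall (m m' : M) (xi y : R), (0 < xi)%R -> (0 < y)%R ->
    (tau * (Num.max (dm m) (dm m') + xi) <= y ^+ 2)%R ->
    mu_ext P [set w | z%:E <= ereal_sup
        [set Zproc mu s (obs N w) tt.1 tt.2 / w2 mu s tt.1 tt.2 y
           | tt in S m `*` S m']]
    <= (gamma * expR (- xi))%:E.

End Models.

(* Main.v *)
Require Import Defs.
From HB Require Import structures.
From mathcomp Require Import all_boot all_order all_algebra.
From mathcomp Require Import all_classical all_reals all_analysis measurable_realfun.
From mathcomp Require Import ring lra.
Set Implicit Arguments.
Unset Strict Implicit.
Unset Printing Implicit Defensive.
Import Order.TTheory GRing.Theory Num.Theory.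
Local Open Scope classical_set_scope.
Local Open Scope ring_scope.

(** Write H^2 for the loss, k for 1/sqrt 2 and r for the midpoint of t and t'.
    Replacing the observed measure by its intensity s in the test comparing t
    with t' costs exactly Z(N,t,t'), and the remaining deterministic part can
    be compared with the loss: a pointwise inequality between square roots,
    [drift_pointwise], integrates to [Ttest_drift],
      T(N,t,t') <= (1+k) H^2(s,t) - (1-k) H^2(s,t') + pen t - pen t' + Z(N,t,t').
    On an observation for which every supremum of Z/w^2 over S_m x S_m', taken
    at the level y^2 = tau (max(d_m, d_m') + Delta_m + Delta_m' + xi), is below
    z, one has Z <= z w^2 <= z (H^2(s,t) + H^2(s,t')) + z y^2.  Optimizing over
    the models containing t and t', the lower bound on the penalty absorbs
    z y^2 into pen t + pen t' + z tau xi.  The penalty of t' then cancels, and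
    since z < 1 - k, a challenger t' beating t satisfies
      (1-k-z) H^2(s,t') <= 3 H^2(s,t) + 2 pen t + tau xi   ([challenger_close]).
    So D(t) is at most a constant times H^2(s,t) + pen t + tau xi.  Among two
    estimators one always beats the other, hence the distance between the
    selected estimator and any shat_l is at most D(shat_l) + tau, and the
    triangle inequality gives [selection_bound]: the loss of the selected
    estimator is at most A (H^2(s,shat_l) + pen(shat_l) + tau (xi + 1)) for
    all l, where A depends only on z.

    By the union bound over pairs of models, the observation is unfavourable at
    level xi with outer probability at most gamma Sigma^2 e^(-xi).  Taking
    xi = n + 1 and a measurable cover B_n of the unfavourable event, the first
    n for which B_n does not occur is at most the number of B_n which occur, a
    random variable whose mean is at most 2 max(gamma Sigma^2, 1).  Integrating
    the bound at this random level gives the risk bound with C = 1/(4A).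

    Neither the selected index, nor the penalty, nor therefore the infimum over
    the family has to be measurable, so the integrals are lower integrals.
    These are not additive, but they satisfy the one inequality which the
    argument needs, [lower_integral_le_add]: a measurable nonnegative summand
    can be split off from an upper bound.

    When the penalty attains its lower bound, it is at most 2 v^2 because
    d + Delta <= 2 max(d, Delta) and z < 1, and the remainder is at most
    max(gamma Sigma^2, 1) times the mean of v^2, because Delta >= 1 implies
    v^2 >= tau. *)

(** * Pointwise analysis of the test *)

Section Pointwise.
Context {R : realType}.
Implicit Types a b c : R.

(** Both the ratios sqrt(t/r), with r the midpoint of t and t', and the function
    psi are expressed through this bounded quantity, which the convention
    0 / 0 = 0 of the field makes total. *)
Definition sqrt_share a b : R := Num.sqrt (a / (a + b)).

Definition psiR a b : R :=
  (Num.sqrt 2)^-1 * (sqrt_share b a - sqrt_share a b).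

Lemma sqrt_share_bounds a b : 0 <= a -> 0 <= b -> 0 <= sqrt_share a b <= 1.
Proof.
move=> a0 b0; rewrite sqrtr_ge0 /= -[leRHS]sqrtr1 ler_wsqrtr//.
have [->|ab0] := eqVneq (a + b) 0; first by rewrite invr0 mulr0.
by rewrite ler_pdivrMr ?mul1r ?lerDl// lt_neqAle eq_sym ab0 addr_ge0.
Qed.

Lemma inv_sqrt2_gt0 : 0 < (Num.sqrt 2)^-1 :> R.
Proof. by rewrite invr_gt0 sqrtr_gt0 ltr0n. Qed.

Lemma inv_sqrt2_lt1 : (Num.sqrt 2)^-1 < 1 :> R.
Proof.
by rewrite invf_lt1 ?sqrtr_gt0 ?ltr0n// -[ltLHS]sqrtr1 ltr_sqrt ?ltr0n ?ltr1n.
Qed.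

Lemma norm_psiR_le1 a b : 0 <= a -> 0 <= b -> `|psiR a b| <= 1.
Proof.
move=> a0 b0; rewrite normrM (ger0_norm (ltW inv_sqrt2_gt0)).
have /andP[A0 A1] := @sqrt_share_bounds a b a0 b0.
have /andP[B0 B1] := @sqrt_share_bounds b a b0 a0.
have H : `|sqrt_share b a - sqrt_share a b| <= 1.
  by rewrite ler_norml; apply/andP; split; lra.
by rewrite mulr_ile1// ?(ltW inv_sqrt2_gt0)// (ltW inv_sqrt2_lt1).
Qed.

Lemma sqrte_quotient_midpoint a b : 0 <= a -> 0 <= b ->
  sqrte (a%:E / ((a + b) / 2)%:E)%E = (Num.sqrt 2 * sqrt_share a b)%:E.
Proof.
move=> a0 b0; rewrite inver; case: ifPn => [|ab0].
  rewrite mulf_eq0 invr_eq0 (gt_eqF (ltr0n _ 2)) orbF paddr_eq0//.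
  move=> /andP[/eqP-> /eqP->].
  by rewrite mul0e sqrte0 /sqrt_share mul0r sqrtr0 mulr0.
rewrite -EFinM /= /sqrt_share -sqrtrM// invf_div; congr (Num.sqrt _)%:E.
by rewrite mulrCA.
Qed.

Lemma sqrte_share a b : 0 <= a -> 0 <= b -> b != 0 ->
  sqrte (1 / (1 + a%:E / b%:E))%E = (sqrt_share b a)%:E.
Proof.
move=> a0 b0 bn0; rewrite inver (negbTE bn0) -EFinM -EFinD inver.
have bp : 0 < b by rewrite lt_neqAle eq_sym bn0.
have q0 : 0 <= a / b by rewrite divr_ge0.
rewrite gt_eqF ?ltr_wpDr// mul1e /= /sqrt_share; congr (Num.sqrt _)%:E.
have abn0 : b + a != 0 by rewrite gt_eqF// ltr_wpDr.
by field; rewrite abn0 bn0.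
Qed.

(** When a = b = 0 the two square roots in psi equal 1 in the extended reals and 0
    in [psiR], so that both differences vanish. *)
Lemma psiE a b : 0 <= a -> 0 <= b -> psi a b = (psiR a b)%:E.
Proof.
move=> a0 b0; rewrite /psi /psiR EFinM; congr (_ * _)%E; rewrite EFinB.
have [->|an0] := eqVneq a 0; have [->|bn0] := eqVneq b 0.
- by rewrite mul0e adde0 div1e inve1 /sqrt_share /= mul0r sqrtr0 sqrtr1 -!EFinD !subrr.
- rewrite sqrte_share// inve0 gt0_muley ?lte_fin ?lt_neqAle ?b0 1?eq_sym ?bn0//.
  by rewrite addey// invey mule0 sqrte0 {3}/sqrt_share mul0r sqrtr0.
- rewrite inve0 gt0_muley ?lte_fin ?lt_neqAle ?a0 1?eq_sym ?an0//.
  rewrite addey// invey mule0 sqrte0 mul0e adde0 inve1 mule1 /sqrt_share.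
  by rewrite mul0r sqrtr0 addr0 divff//= sqrtr1.
- by rewrite !sqrte_share.
Qed.

(** With A, B, C, r the square roots of a, b, c and of the midpoint, and
    q = (B - A) / r, completing the square (AM-GM) turns the left-hand side into
      (C - A)^2 / 2 - (C - B)^2 / 2 + q (C - r)^2 / 2.
    Since B <= sqrt 2 r, q is at most sqrt 2, and the concavity of the square
    root, A + B <= 2 r, gives 2 (C - r)^2 <= (C - A)^2 + (C - B)^2. *)
Lemma drift_pointwise a b c : 0 <= a -> 0 <= b -> 0 <= c ->
  2^-1 * Num.sqrt (b * ((a + b) / 2)) - 2^-1 * Num.sqrt (a * ((a + b) / 2))
   - 2^-1 * b + 2^-1 * a + psiR a b * c
  <= (1 + (Num.sqrt 2)^-1) * (2^-1 * (Num.sqrt c - Num.sqrt a) ^+ 2)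
     - (1 - (Num.sqrt 2)^-1) * (2^-1 * (Num.sqrt c - Num.sqrt b) ^+ 2).
Proof.
move=> a0 b0 c0; set k := (Num.sqrt 2)^-1.
have k0 : 0 < k := inv_sqrt2_gt0.
have k2 : k * k = 2^-1 by rewrite -invfM -expr2 sqr_sqrtr ?ler0n.
have [/eqP|r0] := eqVneq (a + b) 0.
  rewrite paddr_eq0// => /andP[/eqP-> /eqP->].
  rewrite /psiR /sqrt_share !mul0r !sqrtr0 !(mulr0, mul0r, subr0, addr0, subrr).
  have := sqr_ge0 (Num.sqrt c); set x := _ ^+ 2 => x0; nra.
have abp : 0 < a + b by rewrite lt_neqAle eq_sym r0 addr_ge0.
have e2 : 2 * ((a + b) / 2) = a + b by rewrite mulrC divfK// pnatr_eq0.
have rp : 0 < (a + b) / 2 by rewrite divr_gt0.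
move: ((a + b) / 2) e2 rp => r e2 rp; rewrite (sqrtrM _ b0) (sqrtrM _ a0).
have -> : psiR a b = 2^-1 * ((Num.sqrt b - Num.sqrt a) / Num.sqrt r).
  rewrite /psiR /sqrt_share (addrC b a) (sqrtrM _ b0) (sqrtrM _ a0).
  have -> : Num.sqrt (a + b)^-1 = k * (Num.sqrt r)^-1.
    by rewrite -e2 sqrtrV ?mulr_ge0 ?ler0n ?(ltW rp)// -invfM -sqrtrM ?ler0n.
  rewrite -/k -k2; ring.
have ea := sqr_sqrtr a0; have eb := sqr_sqrtr b0; have ec := sqr_sqrtr c0.
have er := sqr_sqrtr (ltW rp).
have A0 := sqrtr_ge0 a; have B0 := sqrtr_ge0 b; have C0 := sqrtr_ge0 c.
have R0 : 0 < Num.sqrt r by rewrite sqrtr_gt0.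
rewrite -[X in _ - 2^-1 * X + _]eb -[X in _ + 2^-1 * X + _]ea -[X in _ + _ * X <= _]ec.
rewrite -er -ea -eb in e2; move: e2.
move: (Num.sqrt a) (Num.sqrt b) (Num.sqrt c) (Num.sqrt r) A0 B0 C0 R0.
move=> A B C Rr A0 B0 C0 R0 e2.
set q := (B - A) / Rr.
have eq_q : q * Rr = B - A by rewrite /q divfK// gt_eqF.
clearbody q.
have hq : k * q <= 1.
  have : k * (q * Rr) <= Rr.
    rewrite eq_q; have [|/ltW H] := leP (k * (B - A)) 0.
      by move/le_trans; apply; exact: ltW.
    rewrite -(@ler_pXn2r _ 2) ?nnegrE ?(ltW R0)//.
    rewrite exprMn expr2 k2.
    have [H1|H1] := leP (B - A) 0; first by nra.
    nra.
  by rewrite mulrA -[leRHS]mul1r ler_pM2r.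
have hR : A + B <= 2 * Rr.
  rewrite -(@ler_pXn2r _ 2) ?nnegrE; [|done|nra|nra].
  have := sqr_ge0 (A - B); nra.
have D : 0 <= (C - A) ^+ 2 + (C - B) ^+ 2 - 2 * (C - Rr) ^+ 2 by nra.
have key : q * (C - Rr) ^+ 2 <= k * ((C - A) ^+ 2 + (C - B) ^+ 2).
  have k21 : 2 * (k * k) = 1 by rewrite k2 mulfV// pnatr_eq0.
  have q2k : q <= 2 * k.
    have E : q = 2 * k * (k * q) by rewrite -mulrA (mulrA k) mulrA k21 mul1r.
    by rewrite [leLHS]E -[leRHS]mulr1 ler_wpM2l// mulr_ge0// ltW.
  apply: (@le_trans _ _ (2 * k * (C - Rr) ^+ 2)).
    by rewrite ler_wpM2r// sqr_ge0.
  rewrite -subr_ge0 [X in 0 <= X](_ : _ = k * ((C - A) ^+ 2 + (C - B) ^+ 2 - 2 * (C - Rr) ^+ 2)); last by ring.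
  by rewrite mulr_ge0// ltW.
have BA : B = A + q * Rr by rewrite eq_q; ring.
have id1 : 2^-1 * (B * Rr) - 2^-1 * (A * Rr) - 2^-1 * B ^+ 2 + 2^-1 * A ^+ 2 + 2^-1 * q * C ^+ 2
  = 2^-1 * (C - A) ^+ 2 - 2^-1 * (C - B) ^+ 2 + 2^-1 * (q * (C - Rr) ^+ 2).
  by rewrite BA; field.
by rewrite id1; lra.
Qed.

Lemma sqrB_triangle a b c :
  (a - c) ^+ 2 <= 2 * (a - b) ^+ 2 + 2 * (b - c) ^+ 2.
Proof. by have := sqr_ge0 (a - b - (b - c)); nra. Qed.

End Pointwise.

(** * Integrals over tuples, the loss and the test *)

Section TupleIntegrals.
Context {R : realType} {k : nat} {d : 'I_k -> measure_display}
  {X : forall i, measurableType (d i)}.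
Implicit Types (mu nu : mtuple R X) (g h s t : ktuple R X).

Lemma ktupleP g h : (forall i x, g i x = h i x) -> g = h.
Proof.
by move=> gh; apply: functional_extensionality_dep => i; apply/funext => x.
Qed.

Definition L1 nu g := forall i, (nu i).-integrable [set: X i] (EFin \o g i).

Definition Rinteg nu g : R := \sum_(i < k) \int[nu i]_x g i x.

Lemma integE nu g : L1 nu g ->
  integ nu (fun i x => (g i x)%:E) = (Rinteg nu g)%:E.
Proof.
move=> ig; rewrite /Rinteg -sumEFin /integ; apply: eq_bigr => i _.
by rewrite /Rintegral fineK//; apply: integrable_fin_num => //; exact: ig.
Qed.

Lemma L1D nu g h : L1 nu g -> L1 nu h -> L1 nu (fun i x => g i x + h i x).
Proof. by move=> ig ih i; have := integrableD measurableT (ig i) (ih i). Qed.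

Lemma L1B nu g h : L1 nu g -> L1 nu h -> L1 nu (fun i x => g i x - h i x).
Proof. by move=> ig ih i; have := integrableB measurableT (ig i) (ih i). Qed.

Lemma L1Z nu c g : L1 nu g -> L1 nu (fun i x => c * g i x).
Proof. by move=> ig i; have := integrableZl measurableT c (ig i). Qed.

Lemma RintegD nu g h : L1 nu g -> L1 nu h ->
  Rinteg nu (fun i x => g i x + h i x) = Rinteg nu g + Rinteg nu h.
Proof.
move=> ig ih; rewrite /Rinteg -big_split /=; apply: eq_bigr => i _.
by rewrite RintegralD.
Qed.

Lemma RintegB nu g h : L1 nu g -> L1 nu h ->
  Rinteg nu (fun i x => g i x - h i x) = Rinteg nu g - Rinteg nu h.
Proof.
move=> ig ih; rewrite /Rinteg -sumrB /=; apply: eq_bigr => i _.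
by rewrite RintegralB.
Qed.

Lemma RintegZ nu c g : L1 nu g ->
  Rinteg nu (fun i x => c * g i x) = c * Rinteg nu g.
Proof.
move=> ig; rewrite /Rinteg mulr_sumr; apply: eq_bigr => i _.
by rewrite RintegralZl.
Qed.

Lemma le_Rinteg nu g h : L1 nu g -> L1 nu h ->
  (forall i x, g i x <= h i x) -> Rinteg nu g <= Rinteg nu h.
Proof.
move=> ig ih gh; apply: ler_sum => i _.
by apply: le_Rintegral.
Qed.

Lemma Rinteg_ge0 nu g : (forall i x, 0 <= g i x) -> 0 <= Rinteg nu g.
Proof. by move=> g0; apply: sumr_ge0 => i _; exact: Rintegral_ge0. Qed.

Lemma L1_le nu g h : (forall i, measurable_fun [set: X i] (g i)) ->
  (forall i x, `|g i x| <= `|h i x|) -> L1 nu h -> L1 nu g.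
Proof.
move=> mg gh ih i; apply: le_integrable (ih i) => //.
  exact/measurable_EFinP.
by move=> x _; rewrite /= lee_fin.
Qed.

Definition Tfinite nu := forall i, (nu i [set: X i] < +oo)%E.

Lemma L1_bounded nu g : Tfinite nu ->
  (forall i, measurable_fun [set: X i] (g i)) ->
  (forall i x, `|g i x| <= 1) -> L1 nu g.
Proof.
move=> fnu mg g1 i; apply: measurable_bounded_integrable => //.
by exists 1; split => // M M1 x _ /=; rewrite (le_trans (g1 i x))// ltW.
Qed.

End TupleIntegrals.

Section Measurability.
Context {R : realType} {d : measure_display} {T : measurableType d}.
Implicit Types f g : T -> R.

Lemma measurable_sqrt f :
  measurable_fun [set: T] f -> measurable_fun [set: T] (fun x => Num.sqrt (f x)).
Proof.
move=> mf; apply: (measurableT_comp _ mf).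
by apply: continuous_measurable_fun; exact: sqrt_continuous.
Qed.

(** Inversion is not continuous at 0; on nonnegative reals it is the power -1,
    which is measurable. *)
Lemma measurable_sqrt_share f g :
  (forall x, 0 <= f x) -> (forall x, 0 <= g x) ->
  measurable_fun [set: T] f -> measurable_fun [set: T] g ->
  measurable_fun [set: T] (fun x => sqrt_share (f x) (g x)).
Proof.
move=> f0 g0 mf mg; apply: measurable_sqrt; apply: measurable_funM => //.
rewrite (_ : (fun _ => _) = (fun x => (f x + g x) `^ (-1))); last first.
  by apply/funext => x; rewrite powR_inv1// addr_ge0.
have mfg := measurable_funD mf mg.
exact: (measurableT_comp (measurable_powR (-1)) mfg).
Qed.

End Measurability.

Section HellingerAndTest.
Context {R : realType} {k : nat} {d : 'I_k -> measure_display}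
  {X : forall i, measurableType (d i)}.
Variable mu : mtuple R X.
Implicit Types (nu : mtuple R X) (s t : ktuple R X) (pen : ktuple R X -> R).

Lemma calL_ge0 t : calL mu t -> forall i x, 0 <= t i x.
Proof. by move=> Lt i; case: (Lt i). Qed.

Lemma calL_measurable t : calL mu t -> forall i, measurable_fun [set: X i] (t i).
Proof. by move=> Lt i; case: (Lt i). Qed.

Lemma calL_L1 t : calL mu t -> L1 mu t.
Proof. by move=> Lt i; case: (Lt i). Qed.

(** The real value of [hell2], see [hell2_fin]. *)
Definition hell t t' : R :=
  Rinteg mu (fun i x => 2^-1 * (Num.sqrt (t i x) - Num.sqrt (t' i x)) ^+ 2).

Lemma L1_sqrtM t t' : calL mu t -> calL mu t' ->
  L1 mu (fun i x => Num.sqrt (t i x * t' i x)).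
Proof.
move=> Lt Lt'; apply: (@L1_le _ _ _ _ _ _ (fun i x => t i x + t' i x)).
- move=> i; apply: measurable_sqrt; apply: measurable_funM; exact: calL_measurable.
- move=> i x; have t0 := calL_ge0 Lt x; have t0' := calL_ge0 Lt' x.
  rewrite !ger0_norm ?sqrtr_ge0 ?addr_ge0//.
  rewrite -[leRHS]ger0_norm ?addr_ge0// -sqrtr_sqr ler_wsqrtr//; nra.
- by apply: L1D; exact: calL_L1.
Qed.

Lemma L1_hell t t' : calL mu t -> calL mu t' ->
  L1 mu (fun i x => (Num.sqrt (t i x) - Num.sqrt (t' i x)) ^+ 2).
Proof.
move=> Lt Lt'.
have := L1B (L1D (calL_L1 Lt) (calL_L1 Lt')) (L1Z 2 (L1_sqrtM Lt Lt')).
congr L1; apply/ktupleP => i x.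
have t0 := calL_ge0 Lt x; have t0' := calL_ge0 Lt' x.
rewrite sqrtrM// sqrrB !sqr_sqrtr//; ring.
Qed.

Lemma hell2_fin t t' : calL mu t -> calL mu t' -> hell2 mu t t' = (hell t t')%:E.
Proof.
move=> Lt Lt'; rewrite /hell2 integE; last exact: L1_hell.
by rewrite -EFinM /hell RintegZ//; exact: L1_hell.
Qed.

Lemma hell_ge0 t t' : 0 <= hell t t'.
Proof. by apply: Rinteg_ge0 => i x; rewrite mulr_ge0// ?sqr_ge0. Qed.

Lemma hellC t t' : hell t t' = hell t' t.
Proof.
rewrite /hell; congr Rinteg; apply/ktupleP => i x.
by rewrite -sqrrN opprB.
Qed.

Lemma hell_triangle t t' t'' : calL mu t -> calL mu t' -> calL mu t'' ->
  hell t t'' <= 2 * hell t t' + 2 * hell t' t''.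
Proof.
move=> L1t L1t' L1t''.
have I1 := L1Z 2^-1 (L1_hell L1t L1t').
have I2 := L1Z 2^-1 (L1_hell L1t' L1t'').
have I3 := L1Z 2^-1 (L1_hell L1t L1t'').
rewrite /hell -!RintegZ// -RintegD; [|exact: L1Z..].
apply: le_Rinteg => //; first by apply: L1D; exact: L1Z.
move=> i x; have := sqrB_triangle (Num.sqrt (t i x)) (Num.sqrt (t' i x)) (Num.sqrt (t'' i x)); lra.
Qed.

Lemma calL_midpoint t t' : calL mu t -> calL mu t' -> calL mu (midpoint t t').
Proof.
move=> Lt Lt' i; split.
- by move=> x; rewrite divr_ge0// addr_ge0// ?(calL_ge0 Lt) ?(calL_ge0 Lt').
- apply: measurable_funM => //; apply: measurable_funD; exact: calL_measurable.
- have := L1Z 2^-1 (L1D (calL_L1 Lt) (calL_L1 Lt')) i; congr integrable.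
  by apply/funext => x /=; rewrite mulrC.
Qed.

Definition psi_tuple t t' : ktuple R X := fun i x => psiR (t i x) (t' i x).
Arguments psi_tuple : clear implicits.

Lemma measurable_psi_tuple t t' : calL mu t -> calL mu t' ->
  forall i, measurable_fun [set: X i] (psi_tuple t t' i).
Proof.
move=> Lt Lt' i; apply: measurable_funM => //; apply: measurable_funB;
  apply: measurable_sqrt_share; by [exact: calL_ge0|exact: calL_measurable].
Qed.

Lemma L1_sqrt_share nu t t' : Tfinite nu -> calL mu t -> calL mu t' ->
  L1 nu (fun i x => sqrt_share (t i x) (t' i x)).
Proof.
move=> fnu Lt Lt'; apply: L1_bounded => //.
  by move=> i; apply: measurable_sqrt_share;
    by [exact: calL_ge0|exact: calL_measurable].
move=> i x; have /andP[s0 s1] := sqrt_share_bounds (calL_ge0 Lt x) (calL_ge0 Lt' x).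
by rewrite ger0_norm.
Qed.

Lemma L1_psi_tuple nu t t' : Tfinite nu -> calL mu t -> calL mu t' ->
  L1 nu (psi_tuple t t').
Proof.
move=> fnu Lt Lt'; apply: L1_bounded => //; first exact: measurable_psi_tuple.
by move=> i x; apply: norm_psiR_le1; exact: calL_ge0.
Qed.

Lemma L1_psi_tupleM s t t' : calL mu s -> calL mu t -> calL mu t' ->
  L1 mu (fun i x => psi_tuple t t' i x * s i x).
Proof.
move=> Ls Lt Lt'; apply: (L1_le _ _ (calL_L1 Ls)).
  move=> i; apply: measurable_funM; first exact: measurable_psi_tuple.
  exact: calL_measurable.
move=> i x; rewrite normrM ler_piMl//.
by apply: norm_psiR_le1; exact: calL_ge0.
Qed.

(** The real value of [Zproc] for a finite measure, see [ZprocE]. *)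
Definition Zreal s nu t t' : R :=
  Rinteg nu (psi_tuple t t') - Rinteg mu (fun i x => psi_tuple t t' i x * s i x).

Lemma ZprocE nu s t t' : Tfinite nu -> calL mu s -> calL mu t -> calL mu t' ->
  Zproc mu s nu t t' = (Zreal s nu t t')%:E.
Proof.
move=> fnu Ls Lt Lt'; rewrite /Zproc /Zreal EFinB -!integE; last 2 first.
- exact: L1_psi_tupleM.
- exact: L1_psi_tuple.
rewrite /integ; congr (_ - _)%E; apply: eq_bigr => i _; apply: eq_integral => x _;
  by rewrite psiE//; exact: calL_ge0.
Qed.

(** The real value of the criterion at t when t is tested against t', see
    [critE]. *)
Definition crit_real pen nu t t' : R :=
  2^-1 * (Rinteg mu (fun i x => Num.sqrt (t i x * ((t i x + t' i x) / 2))) +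
          Num.sqrt 2 * Rinteg nu (fun i x => sqrt_share (t i x) (t' i x)))
  - 2^-1 * Rinteg mu t - pen t.

Lemma critE pen nu t t' : Tfinite nu -> calL mu t -> calL mu t' ->
  crit mu pen nu (midpoint t t') t = (crit_real pen nu t t')%:E.
Proof.
move=> fnu Lt Lt'; rewrite /crit /rho_r /rho.
rewrite (integE (L1_sqrtM Lt (calL_midpoint Lt Lt'))).
rewrite (integE (calL_L1 Lt)).
have -> : integ nu (fun i x => sqrte ((t i x)%:E / (midpoint t t' x)%:E)%E)
    = (Num.sqrt 2 * Rinteg nu (fun i x => sqrt_share (t i x) (t' i x)))%:E.
  have Ish := L1_sqrt_share fnu Lt Lt'.
  rewrite -(RintegZ _ Ish) -(integE (L1Z (Num.sqrt 2) Ish)).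
  rewrite /integ; apply: eq_bigr => i _; apply: eq_integral => x _.
  by rewrite sqrte_quotient_midpoint//; exact: calL_ge0.
by [].
Qed.

Lemma midpointC t t' : midpoint t t' = midpoint t' t.
Proof. by apply/ktupleP => i x; rewrite /midpoint addrC. Qed.

Lemma TtestE pen nu t t' : Tfinite nu -> calL mu t -> calL mu t' ->
  Ttest mu pen nu t t' = (crit_real pen nu t' t - crit_real pen nu t t')%:E.
Proof.
by move=> fnu Lt Lt'; rewrite /Ttest /= {1}midpointC !critE.
Qed.

(** The difference of the two integrals of sqrt(t/r) against nu is the integral
    of psi, which is Zreal plus the integral of psi s; the latter joins the
    affinities and masses in [drift_pointwise]. *)
Lemma Ttest_drift pen nu s t t' :
    Tfinite nu -> calL mu s -> calL mu t -> calL mu t' ->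
  crit_real pen nu t' t - crit_real pen nu t t' <=
  (1 + (Num.sqrt 2)^-1) * hell s t - (1 - (Num.sqrt 2)^-1) * hell s t'
  + pen t - pen t' + Zreal s nu t t'.
Proof.
move=> fnu Ls Lt Lt'.
have Lr := calL_midpoint Lt Lt'.
pose r1 : ktuple R X := fun i x => Num.sqrt (t i x * ((t i x + t' i x) / 2)).
pose r2 : ktuple R X := fun i x => Num.sqrt (t' i x * ((t i x + t' i x) / 2)).
have Ir1 : L1 mu r1 := L1_sqrtM Lt Lr.
have Ir2 : L1 mu r2 := L1_sqrtM Lt' Lr.
have It := calL_L1 Lt; have It' := calL_L1 Lt'.
have Ip := L1_psi_tupleM Ls Lt Lt'.
have I1 := L1B (L1Z 2^-1 Ir2) (L1Z 2^-1 Ir1).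
have I2 := L1B I1 (L1Z 2^-1 It').
have I3 := L1D I2 (L1Z 2^-1 It).
have I4 := L1D I3 Ip.
have Ha := L1Z 2^-1 (L1_hell Ls Lt).
have Hb := L1Z 2^-1 (L1_hell Ls Lt').
have Hc := L1B (L1Z (1 + (Num.sqrt 2)^-1) Ha) (L1Z (1 - (Num.sqrt 2)^-1) Hb).
have := le_Rinteg I4 Hc (fun=> fun x => drift_pointwise (calL_ge0 Lt x)
   (calL_ge0 Lt' x) (calL_ge0 Ls x)).
rewrite (RintegD I3 Ip) (RintegD I2 (L1Z _ It)) (RintegB I1 (L1Z _ It')).
rewrite (RintegB (L1Z _ Ir2) (L1Z _ Ir1)) (RintegB (L1Z _ Ha) (L1Z _ Hb)).
rewrite (RintegZ _ Ir1) (RintegZ _ Ir2) (RintegZ _ It) (RintegZ _ It').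
rewrite (RintegZ _ Ha) (RintegZ _ Hb) -/(hell s t) -/(hell s t').
have s1 := L1_sqrt_share fnu Lt Lt'.
have s2 := L1_sqrt_share fnu Lt' Lt.
have -> : Zreal s nu t t' = (Num.sqrt 2)^-1 * (Rinteg nu (fun i x => sqrt_share (t' i x) (t i x))
    - Rinteg nu (fun i x => sqrt_share (t i x) (t' i x)))
    - Rinteg mu (fun i x => psi_tuple t t' i x * s i x).
  by rewrite /Zreal -RintegB// -RintegZ//; exact: L1B.
have -> : Rinteg mu r2 = Rinteg mu (fun i x => Num.sqrt (t' i x * ((t' i x + t i x) / 2))).
  by congr Rinteg; apply/ktupleP => i x; rewrite /r2 (addrC (t i x)).
have k2 : Num.sqrt 2 = 2 * (Num.sqrt 2)^-1 :> R.
  by rewrite -[X in _ = X * _](@sqr_sqrtr R) ?ler0n// expr2 mulfK// sqrtr_eq0 -ltNge ltr0n.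
rewrite /crit_real [X in X * Rinteg nu _]k2.
rewrite [X in _ - (2^-1 * (_ + X * _) - _ - _) <= _]k2.
rewrite -/r1.
lra.
Qed.

End HellingerAndTest.

(** * The selected estimator on a favourable observation *)

Section Selection.
Context {R : realType} {k : nat} {d : 'I_k -> measure_display}
  {X : forall i, measurableType (d i)} {M : countType}.
Variables (mu nu : mtuple R X) (s : ktuple R X) (S : M -> set (ktuple R X)).
Variables (z tau xi : R) (Delta dm : M -> R) (pen : ktuple R X -> R).

(** The summand Delta m + Delta m' makes the deviation probabilities summable
    over pairs of models. *)
Definition pair_level (m m' : M) (x : R) : R :=
  tau * (Num.max (dm m) (dm m') + (Delta m + Delta m' + x)).

Definition good_obs := forall m m' : M, (ereal_sup
  [set Zproc mu s nu tt.1 tt.2 / w2 mu s tt.1 tt.2 (Num.sqrt (pair_level m m' xi))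
     | tt in S m `*` S m'] < z%:E)%E.

(** The coefficient of the loss of a challenger in the test, once the
    fluctuations are bounded. *)
Definition gap : R := 1 - (Num.sqrt 2)^-1 - z.
Definition selection_cst : R := 6 + 12 / gap.

Hypotheses (z0 : 0 < z) (z1 : z < 1 - (Num.sqrt 2)^-1) (tau0 : 0 < tau) (xi0 : 0 < xi).
Hypotheses (D0 : forall m, 0 <= Delta m) (d0 : forall m, 0 < dm m).
Hypothesis fnu : Tfinite nu.
Hypothesis Ls : calL mu s.
Hypothesis SL : forall m, S m `<=` calL mu.
Hypothesis pen0 : forall t, bbS S t -> 0 <= pen t.
Hypothesis pen_large : forall t, bbS S t -> pen_bound S z tau dm Delta t <= pen t.

Lemma bbS_calL t : bbS S t -> calL mu t.
Proof. by case=> m _ /SL. Qed.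

Lemma pair_level_gt0 m m' : 0 < pair_level m m' xi.
Proof.
rewrite /pair_level mulr_gt0// addr_gt0 ?lt_max ?d0//.
by rewrite ltr_wpDl// addr_ge0.
Qed.

Lemma Z_le_level m m' t t' : good_obs -> S m t -> S m' t' ->
  Zreal mu s nu t t' <=
  z * (hell mu s t + hell mu s t')
  + z * tau * ((dm m + Delta m) + (dm m' + Delta m') + xi).
Proof.
move=> good Smt Smt'; have Lt := SL Smt; have Lt' := SL Smt'.
have h0 := hell_ge0 mu s t; have h0' := hell_ge0 mu s t'.
have y0 := pair_level_gt0 m m'.
have : (Zproc mu s nu t t' / w2 mu s t t' (Num.sqrt (pair_level m m' xi)) < z%:E)%E.
  by apply: le_lt_trans (good m m'); apply: ereal_sup_ubound; exists (t, t').
rewrite ZprocE// /w2 !hell2_fin// -EFinD -EFin_max sqr_sqrtr ?(ltW y0)//.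
set W := Num.max _ _; have W0 : 0 < W by rewrite lt_max y0 orbT.
rewrite inver gt_eqF// -EFinM lte_fin ltr_pdivrMr// => /ltW/le_trans; apply.
have WL : W <= hell mu s t + hell mu s t' + pair_level m m' xi.
  by rewrite ge_max lerDl (ltW y0)/= lerDr addr_ge0.
apply: (le_trans (ler_wpM2l (ltW z0) WL)).
rewrite mulrDr lerD2l /pair_level mulrA ler_wpM2l ?mulr_ge0 ?(ltW z0) ?(ltW tau0)//.
have : Num.max (dm m) (dm m') <= dm m + dm m'.
  by rewrite ge_max lerDl lerDr !(ltW (d0 _)).
lra.
Qed.

Lemma le_inf_add (A B : set R) x : A !=set0 -> B !=set0 ->
  (forall a b, A a -> B b -> x <= a + b) -> x <= inf A + inf B.
Proof.
move=> A0 B0 h; rewrite -lerBlDr; apply: lb_le_inf => // a Aa.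
rewrite lerBlDr addrC -lerBlDr; apply: lb_le_inf => // b Bb.
by rewrite lerBlDr addrC h.
Qed.

(** The bound [Z_le_level] holds for all models containing t and t', and it
    splits as a sum of a term in m and a term in m'; both infima can be taken
    separately and are then absorbed by the penalties. *)
Lemma Z_le_pen t t' : good_obs -> bbS S t -> bbS S t' ->
  Zreal mu s nu t t' <=
  z * (hell mu s t + hell mu s t') + pen t + pen t' + z * tau * xi.
Proof.
move=> good St St'; have zt : 0 < z * tau by rewrite mulr_gt0.
have P1 := pen_large St; have P2 := pen_large St'.
apply: le_trans (_ : z * (hell mu s t + hell mu s t') +
  pen_bound S z tau dm Delta t + pen_bound S z tau dm Delta t' + z * tau * xi <= _); last by lra.
suff : (Zreal mu s nu t t' - z * (hell mu s t + hell mu s t')) / (z * tau) - xi <=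
    inf [set dm m + Delta m | m in calM S t] + inf [set dm m + Delta m | m in calM S t'].
  rewrite lerBlDr ler_pdivrMr// /pen_bound; lra.
apply: le_inf_add.
- by case: St => m _ Sm; exists (dm m + Delta m), m.
- by case: St' => m _ Sm; exists (dm m + Delta m), m.
- move=> _ _ [m Sm <-] [m' Sm' <-]; rewrite lerBlDr ler_pdivrMr//.
  have := Z_le_level good Sm Sm'; lra.
Qed.

Lemma gap_gt0 : 0 < gap.
Proof. by rewrite /gap subr_gt0. Qed.

(** In the test, the penalty pen t' coming from the fluctuations cancels the one
    in the criterion of t', so that only the loss and the penalty of t
    remain.  The constant 3 bounds 1 + 1/sqrt 2 + z. *)
Lemma challenger_close t t' : good_obs -> bbS S t -> bbS S t' ->
  (0 <= Ttest mu pen nu t t')%E ->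
  gap * hell mu s t' <= 3 * hell mu s t + 2 * pen t + tau * xi.
Proof.
move=> good St St'; have Lt := bbS_calL St; have Lt' := bbS_calL St'.
rewrite TtestE// lee_fin => T0.
have := Ttest_drift pen fnu Ls Lt Lt'; have := Z_le_pen good St St'.
have h0 := hell_ge0 mu s t.
have k0 := @inv_sqrt2_gt0 R; have k1 := @inv_sqrt2_lt1 R; have zk := z1.
rewrite /gap; move: T0; set k2 := (Num.sqrt 2)^-1 in zk k0 k1 *.
have ztx : z * tau * xi <= tau * xi.
  by rewrite -mulrA ler_piMl ?mulr_ge0 ?ltW//; lra.
have : (1 + k2 + z) * hell mu s t <= 3 * hell mu s t by rewrite ler_wpM2r//; lra.
lra.
Qed.

Lemma hell_le_div t' x : gap * hell mu s t' <= x -> hell mu s t' <= x / gap.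
Proof. by rewrite ler_pdivlMr ?gap_gt0// mulrC. Qed.

(** By [challenger_close] all the challengers t' which beat t are close to s,
    hence close to t: H^2(t,t') is at most 2 H^2(s,t) + 2 H^2(s,t'). *)
Lemma calD_le (F : set (ktuple R X)) t : F `<=` bbS S -> good_obs -> bbS S t ->
  (calD mu pen nu F t <=
    ((2 + 6 / gap) * (hell mu s t + pen t + tau * xi))%:E)%E.
Proof.
move=> FS good St; have Lt := bbS_calL St.
have h0 := hell_ge0 mu s t; have p0 := pen0 St.
have tx0 : 0 < tau * xi by rewrite mulr_gt0.
have t0 := tau0.
have g0 : 0 < gap^-1 by rewrite invr_gt0 gap_gt0.
rewrite /calD; case: ifP => _.
  by rewrite lee_fin mulr_ge0//; nra.
apply: ge_ereal_sup => _ [t' [Ft' _ T0] <-].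
have St' := FS _ Ft'; have Lt' := bbS_calL St'.
rewrite hell2_fin// lee_fin.
have := hell_le_div (challenger_close good St St' T0).
have := hell_triangle Lt Ls Lt'; rewrite (hellC mu t s); nra.
Qed.

(** Either t beats st, and their distance enters calD st, or st beats t, and it
    enters calD t.  By the choice of st it is at most calD t + tau in both
    cases. *)
Lemma selection_bound (F : set (ktuple R X)) st t :
  F `<=` bbS S -> good_obs -> F st -> F t ->
  (calD mu pen nu F st <= calD mu pen nu F t + tau%:E)%E ->
  hell mu s st <= selection_cst * (hell mu s t + pen t + tau * (xi + 1)).
Proof.
move=> FS good Fst Ft sel.
have St := FS _ Ft; have Sst := FS _ Fst.
have Lt := bbS_calL St; have Lst := bbS_calL Sst.
have h0 := hell_ge0 mu s t; have p0 := pen0 St.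
have tx0 : 0 < tau * xi by rewrite mulr_gt0.
have t0 := tau0.
have g0 : 0 < gap^-1 by rewrite invr_gt0 gap_gt0.
have [->|neq] := pselect (st = t).
  have q0 : 0 <= 12 / gap * (hell mu s t + pen t + tau * (xi + 1)).
    by rewrite mulr_ge0 ?mulr_ge0 ?(ltW g0)//; lra.
  by rewrite /selection_cst mulrDl; lra.
have key : (hell2 mu t st <= calD mu pen nu F t + tau%:E)%E.
  have [T0|T0] := leP 0%E (Ttest mu pen nu st t).
    apply: le_trans sel; rewrite hell2_fin// hellC -hell2_fin// /calD ifF.
      apply: ereal_sup_ubound; exists t => //; split => //; exact/nesym.
    apply/negbTE/set0P; exists t; split => //; exact/nesym.
  have T1 : (0 <= Ttest mu pen nu t st)%E.
    move: T0; rewrite !TtestE// lte_fin lee_fin; lra.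
  rewrite /calD ifF; last by apply/negbTE/set0P; exists st.
  apply: (@le_trans _ _ (ereal_sup [set hell2 mu t t' | t' in calE mu pen nu F t])).
    by apply: ereal_sup_ubound; exists st.
  by rewrite leeDl// lee_fin ltW.
have := le_trans key (leeD2r tau%:E (calD_le FS good St)).
rewrite hell2_fin// -EFinD lee_fin => {}key.
have := hell_triangle Ls Lt Lst; rewrite /selection_cst.
have : 0 <= gap^-1 * tau by rewrite mulr_ge0 ?ltW.
move: key; lra.
Qed.

End Selection.

(** * Lower integrals and outer measures *)

Local Open Scope ereal_scope.

Section LowerIntegral.
Import HBNNSimple.
Context {R : realType} {d0 : measure_display} {T : measurableType d0}.
Variable P : {measure set T -> \bar R}.
Implicit Types f g h : T -> \bar R.

(** Integrals of nonnegative functions are suprema over simple functions, so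
    that they are monotone without any measurability. *)
Lemma le_lower_integral f g : (forall w, 0 <= f w) -> (forall w, f w <= g w) ->
  \int[P]_w f w <= \int[P]_w g w.
Proof.
move=> f0 fg; have g0 w : 0 <= g w by apply: le_trans (fg w).
rewrite !ge0_integralTE//; apply: ereal_sup_le => _ [u uf <-].
by exists u => // w; apply: le_trans (fg w).
Qed.

(** For a simple function u below f, the positive part of c u - h is measurable
    and almost everywhere at most g, hence its integral is at most the lower
    integral of g, even though g need not be measurable. *)
Lemma lower_integral_le_add f g h (c : R) : (0 < c)%R ->
  (forall w, 0 <= f w) -> (forall w, 0 <= g w) -> (forall w, 0 <= h w) ->
  measurable_fun [set: T] h -> {ae P, forall w, c%:E * f w <= g w + h w} ->
  c%:E * \int[P]_w f w <= \int[P]_w g w + \int[P]_w h w.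
Proof.
move=> c0 f0 g0 h0 mh [Z [mZ PZ0 ZP]].
rewrite (ge0_integralTE P f0) -lee_pdivlMl//; apply: ge_ereal_sup => _ [u uf <-].
rewrite lee_pdivlMl//.
have mu_u : measurable_fun [set: T] (fun w => (u w)%:E) by exact/measurable_EFinP.
have u0 w : 0 <= (u w)%:E by rewrite lee_fin; exact: fun_ge0.
have -> : sintegral P u = \int[P]_w (u w)%:E by rewrite integral_nnsfun// patch_setT.
rewrite -ge0_integralZl_EFin//; last exact: ltW.
have mcu : measurable_fun [set: T] (fun w => c%:E * (u w)%:E).
  exact: emeasurable_funM.
pose v := (fun w => maxe (c%:E * (u w)%:E - h w) 0) \_ (~` Z).
have mv : measurable_fun [set: T] v.
  apply/(measurable_restrictT _ (measurableC mZ)).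
  apply: measurable_funTS; apply: measurable_maxe => //.
  exact: emeasurable_funB.
have v0 w : 0 <= v w by rewrite /v patchE; case: ifP => // _; rewrite le_max lexx orbT.
have vg w : v w <= g w.
  rewrite /v patchE; case: ifPn => [|_]; last exact: g0.
  rewrite inE /= => nZw; rewrite ge_max g0 andbT.
  have H : c%:E * f w <= g w + h w by apply: contrapT => /ZP.
  have {}H : c%:E * (u w)%:E <= g w + h w.
    by apply: le_trans H; rewrite lee_pmul2l//; exact: uf.
  move: H (h0 w); case: (h w) => [r| |] //.
  - by move=> H _; rewrite leeBlDr.
  - by move=> _ _; rewrite -EFinM /= leNye.
apply: (@le_trans _ _ (\int[P]_w (v w + h w))).
  apply: ae_ge0_le_integral => //.
  - by move=> w _; rewrite mule_ge0 ?lee_fin ?(ltW c0)//; exact: u0.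
  - by move=> w _; exact: adde_ge0.
  - exact: emeasurable_funD.
  - exists Z; split => // w /= /not_implyP[_ H]; apply: contrapT => nZw; apply: H.
    rewrite /v patchE ifT ?inE//.
    case: (h w) (h0 w) => [r| |] // _.
    + by rewrite -leeBlDr// le_max lexx.
    + by rewrite addey ?leey// gt_eqF// (@lt_le_trans _ _ 0)// ?ltNy0// le_max lexx orbT.
rewrite ge0_integralD//; apply: leeD2r; exact: le_lower_integral.
Qed.

End LowerIntegral.

Section OuterMeasure.
Context {R : realType} {d0 : measure_display} {T : measurableType d0}.
Variable P : {measure set T -> \bar R}.

Lemma mu_ext_measurable_cover (A : set T) (e : \bar R) : mu_ext P A < e ->
  exists B, [/\ measurable B, A `<=` B & P B <= e].
Proof.
move=> /ereal_inf_lt[_ [F [mF AF] <-]] /ltW Fe.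
exists (\bigcup_n F n); split => //; first exact: bigcup_measurable.
by apply: le_trans Fe; apply: measure_sigma_subadditive => //; exact: bigcup_measurable.
Qed.

Lemma esumZl_le (I : choiceType) (a : I -> \bar R) (c : R) : (0 <= c)%R ->
  (forall i, 0 <= a i) ->
  \esum_(i in [set: I]) (c%:E * a i) <= c%:E * \esum_(i in [set: I]) a i.
Proof.
move=> c0 a0; apply: ge_ereal_sup => _ [A finA <-].
rewrite -ge0_mule_fsumr//; apply: lee_wpmul2l; rewrite ?lee_fin//.
by apply: ereal_sup_ubound; exists A.
Qed.

Lemma mu_ext_bigcup_le (I : countType) (A : I -> set T) :
  mu_ext P (\bigcup_i A i) <= \esum_(i in [set: I]) mu_ext P (A i).
Proof.
pose A' n := if pickle_inv n is Some i then A i else set0 : set T.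
have A'E i : A' (pickle i) = A i by rewrite /A' pickleK_inv.
have -> : \bigcup_i A i = \bigcup_n A' n.
  apply/seteqP; split => w [i _ Ai]; first by exists (pickle i) => //; rewrite A'E.
  by move: Ai; rewrite /A'; case: pickle_inv => // j Aj; exists j.
have H := mu_ext_sigma_subadditive (measure_ge0 P) A'.
apply: (le_trans H).
rewrite nneseries_esumT; last by move=> n; exact: mu_ext_ge0.
rewrite [leLHS](_ : _ = \esum_(n in pickle @` [set: I]) mu_ext P (A' n)).
  rewrite esum_image; last by move=> i j _ _; exact: (pcan_inj pickleK_inv).
  by under eq_esum do rewrite A'E.
rewrite [RHS]esum_mkcond; apply: eq_esum => n _; case: ifPn => // nI.
rewrite /A'; case E : (pickle_inv n) => [i|]; last exact: mu_ext0.
by case/negP: nI; rewrite inE; exists i => //; have := @pickle_invK I n; rewrite E.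
Qed.

End OuterMeasure.

(** * Unfavourable observations and the risk bound *)

Section BadEvents.
Context {R : realType} {k : nat} {d : 'I_k -> measure_display}
  {X : forall i, measurableType (d i)} {M : countType}
  {d0 : measure_display} {Omega : measurableType d0}.
Variables (P : probability Omega R) (N : randmeas R X Omega).
Variables (mu : mtuple R X) (s : ktuple R X) (S : M -> set (ktuple R X)).
Variables (z tau gamma Sigma : R) (Delta dm : M -> R).
Hypotheses (tau0 : (0 < tau)%R) (gamma0 : (0 < gamma)%R).
Hypotheses (D0 : forall m, (0 <= Delta m)%R) (dm0 : forall m, (0 < dm m)%R).
Hypothesis esumD : \esum_(m in [set: M]) (expR (- Delta m))%:E = Sigma%:E.
Hypothesis dev : deviation_bound S P mu s N z tau gamma dm.

Definition bad_event (x : R) : set Omega :=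
  [set w | ~ good_obs mu (obs N w) s S z tau x Delta dm].

(** Union bound over pairs of models, with the deviation inequality applied at
    xi = Delta m + Delta m' + x. *)
Lemma mu_ext_bad_event x : (0 < x)%R ->
  mu_ext P (bad_event x) <= (gamma * Sigma ^+ 2 * expR (- x))%:E.
Proof.
move=> x0.
pose bad m m' := [set w | z%:E <= ereal_sup
  [set Zproc mu s (obs N w) tt.1 tt.2 / w2 mu s tt.1 tt.2
        (Num.sqrt (pair_level tau Delta dm m m' x)) | tt in S m `*` S m']].
have bad_le m m' : mu_ext P (bad m m') <=
    (gamma * expR (- x) * expR (- Delta m))%:E * (expR (- Delta m'))%:E.
  have l0 : (0 < pair_level tau Delta dm m m' x)%R by exact: pair_level_gt0.
  have xi0 : (0 < Delta m + Delta m' + x)%R by rewrite ltr_wpDl// addr_ge0.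
  have := dev (m := m) (m' := m') xi0 (y := Num.sqrt (pair_level tau Delta dm m m' x)).
  rewrite sqrtr_gt0 sqr_sqrtr ?(ltW l0)// => /(_ l0 (lexx _)) /le_trans; apply.
  rewrite -EFinM lee_fin !opprD !expRD.
  by rewrite [leRHS](_ : _ = gamma * (expR (- Delta m) * expR (- Delta m') * expR (- x)))%R//; ring.
have -> : bad_event x = \bigcup_m \bigcup_m' bad m m'.
  apply/seteqP; split => w.
    move=> /existsNP[m /existsNP[m' H]]; exists m => //; exists m' => //.
    by rewrite /bad /= leNgt; apply/negP.
  by move=> [m _ [m' _ H]] /(_ m m'); rewrite ltNge; move/negP; apply.
have e0 y : 0 <= (expR y)%:E :> \bar R by rewrite lee_fin expR_ge0.
have step m : mu_ext P (\bigcup_m' bad m m') <=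
    (gamma * expR (- x) * Sigma)%:E * (expR (- Delta m))%:E.
  apply: le_trans (mu_ext_bigcup_le _ _) _.
  apply: le_trans (le_esum (fun m' _ => bad_le m m')) _.
  apply: le_trans (esumZl_le _ (fun m' => e0 _)) _.
    by rewrite !mulr_ge0 ?expR_ge0// ltW.
  by rewrite esumD -!EFinM lee_fin mulrAC.
apply: le_trans (mu_ext_bigcup_le _ _) _.
apply: le_trans (le_esum (fun m _ => step m)) _.
have S0 : (0 <= Sigma)%R by rewrite -lee_fin -esumD; apply: esum_ge0.
apply: le_trans (esumZl_le _ (fun m => e0 _)) _.
  by rewrite !mulr_ge0 ?expR_ge0// ltW.
by rewrite esumD -!EFinM lee_fin expr2; lra.
Qed.

Definition rem_cst : R := Num.max (gamma * Sigma ^+ 2)%R 1%R.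

(** Powers of 1/2 rather than of 1/e, to sum a standard geometric series. *)
Lemma expRN_half n : (expR (- n.+1%:R) <= (2 ^ n.+1)%:R^-1 :> R)%R.
Proof.
rewrite expRN lef_pV2 ?posrE ?expR_gt0 ?ltr0n ?expn_gt0//.
rewrite -[X in expR X]mulr1 expRM_natl natrX ler_pXn2r ?nnegrE ?ler0n ?expR_ge0//.
exact: expR_ge1Dx.
Qed.

(** The outer probability of the unfavourable event need not be attained, and
    the factor 2 leaves room for a measurable cover. *)
Lemma bad_event_cover : {B : nat -> set Omega | forall n,
  [/\ measurable (B n), bad_event n.+1%:R `<=` B n
    & P (B n) <= (2 * rem_cst / (2 ^ n.+1)%:R)%:E]}.
Proof.
suff : forall n, exists B : set Omega, [/\ measurable B, bad_event n.+1%:R `<=` B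
    & P B <= (2 * rem_cst / (2 ^ n.+1)%:R)%:E] by move/choice => [B HB]; exists B.
move=> n; apply: mu_ext_measurable_cover.
apply: le_lt_trans (mu_ext_bad_event _) _; first by rewrite ltr0n.
have K1 : (1 <= rem_cst)%R by rewrite le_max lexx orbT.
have Kg : (gamma * Sigma ^+ 2 <= rem_cst)%R by rewrite le_max lexx.
have p0 : (0 < (2 ^ n.+1)%:R^-1 :> R)%R by rewrite invr_gt0 ltr0n expn_gt0.
rewrite lte_fin; apply: (@le_lt_trans _ _ (rem_cst * (2 ^ n.+1)%:R^-1)%R).
  by apply: ler_pM; rewrite ?expR_ge0 ?expRN_half// mulr_ge0 ?sqr_ge0// ltW.
by rewrite ltr_pM2r//; lra.
Qed.

(** If B n is the first of the B i which does not contain w, then n is at most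
    this count. *)
Definition bad_count (B : nat -> set Omega) (w : Omega) : \bar R :=
  \sum_(n <oo) (\1_(B n) w)%:E.

Lemma bad_count_ge0 B w : 0 <= bad_count B w.
Proof. by apply: nneseries_ge0 => n _ _; rewrite lee_fin. Qed.

Lemma bad_count_ge B w n : (forall i, (i < n)%N -> B i w) ->
  n%:R%:E <= bad_count B w.
Proof.
move=> Bw; apply: le_trans (nneseries_lim_ge n _); last by move=> *; rewrite lee_fin.
rewrite big_mkord (eq_bigr (fun=> 1%:E)); last first.
  by move=> i _; rewrite indicE mem_set//; exact: Bw.
by rewrite sumEFin sumr_const card_ord lee_fin.
Qed.

Section Cover.
Variable B : nat -> set Omega.
Hypothesis mB : forall n, measurable (B n).
Hypothesis PB : forall n, P (B n) <= (2 * rem_cst / (2 ^ n.+1)%:R)%:E.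

Lemma measurable_bad_count : measurable_fun [set: Omega] (bad_count B).
Proof.
apply: ge0_emeasurable_sum => [n w _ _|n _]; first by rewrite lee_fin.
by apply/measurable_EFinP; exact: measurable_indic.
Qed.

Lemma integral_bad_count : \int[P]_w bad_count B w <= (2 * rem_cst)%:E.
Proof.
rewrite integral_nneseries//; last first.
  by move=> n; apply/measurable_EFinP; exact: measurable_indic.
have K0 : (0 <= 2 * rem_cst)%R by rewrite mulr_ge0// le_max ler01 orbT.
apply: le_trans (epsilon_trick0 xpredT K0).
apply: lee_nneseries => [n _ _|n _]; first by apply: integral_ge0 => w _; rewrite lee_fin.
by rewrite integral_indic// setIT; exact: PB.
Qed.

End Cover.
End BadEvents.

Section Observation.
Context {R : realType} {k : nat} {d : 'I_k -> measure_display}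
  {X : forall i, measurableType (d i)}
  {d0 : measure_display} {Omega : measurableType d0}.
Variables (P : probability Omega R) (N : randmeas R X Omega).

Lemma integral_cst_probability (c : \bar R) : \int[P]_w c = c.
Proof.
rewrite (integral_cst P measurableT) -[RHS]mule1; congr (_ * _).
exact: probability_setT.
Qed.

Lemma ae_Tfinite : (forall i, \int[P]_w N i w [set: X i] < +oo) ->
  {ae P, forall w, Tfinite (obs N w)}.
Proof.
move=> Nfin; apply: filter_forall => i.
have : P.-integrable [set: Omega] (fun w => N i w [set: X i]).
  apply/integrableP; split; first exact: (measurable_kernel (N i) _ measurableT).
  by under eq_integral do rewrite gee0_abs//.
move=> /(integrable_ae measurableT); apply: filterS => w /(_ I).
by rewrite ge0_fin_numE.
Qed.

Lemma sigma_obs_measurable A : sigma_obs N A -> measurable A.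
Proof.
apply: smallest_sub; first exact: sigma_algebra_measurable.
move=> _ [i _ [A0 mA0 [B0 mB0 ->]]].
by have := measurable_kernel (N i) A0 mA0 measurableT B0 mB0; rewrite setTI.
Qed.

(** The only measurability which estimators provide; it suffices because the
    loss is the term that is split off by [lower_integral_le_add]. *)
Lemma measurable_estimator_loss mu est t : estimator mu N est -> calL mu t ->
  measurable_fun [set: Omega] (fun w => hell2 mu t (est w)).
Proof.
by move=> Hest Lt _ B0 mB0; rewrite setTI; apply: sigma_obs_measurable; exact: Hest.
Qed.

End Observation.

Section Penalty.
Context {R : realType} {k : nat} {d : 'I_k -> measure_display}
  {X : forall i, measurableType (d i)} {M : countType}.
Variables (S : M -> set (ktuple R X)) (z tau : R) (Delta dm : M -> R).
Hypotheses (z1 : (z < 1)%R) (tau0 : (0 < tau)%R).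
Hypotheses (D1 : forall m, (1 <= Delta m)%R) (dm0 : forall m, (0 < dm m)%R).

Lemma inf_le_mem (A : set R) x y : lbound A x -> A y -> (inf A <= y)%R.
Proof. by move=> Ax Ay; apply: ge_inf => //; exists x. Qed.

Lemma v2_le_model t m : calM S t m ->
  (v2 S tau dm Delta t <= tau * Num.max (dm m) (Delta m))%R.
Proof.
move=> Sm; rewrite ler_pM2l//; apply: (@inf_le_mem _ 0%R); last by exists m.
by move=> _ [m' _ <-]; rewrite le_max ltW.
Qed.

Lemma tau_le_v2 t : bbS S t -> (tau <= v2 S tau dm Delta t)%R.
Proof.
move=> [m _ Sm]; rewrite -[leLHS]mulr1 ler_pM2l//; apply: lb_le_inf.
  by exists (Num.max (dm m) (Delta m)), m.
by move=> _ [m' _ <-]; rewrite le_max D1 orbT.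
Qed.

(** d + Delta is at most twice max(d, Delta), and z < 1. *)
Lemma pen_bound_le_v2 t : bbS S t ->
  (pen_bound S z tau dm Delta t <= 2 * v2 S tau dm Delta t)%R.
Proof.
move=> [m0 _ Sm0]; rewrite /pen_bound /v2.
have i0 : (0 <= inf [set dm m + Delta m | m in calM S t])%R.
  apply: lb_le_inf; first by exists (dm m0 + Delta m0)%R, m0.
  by move=> _ [m _ <-]; rewrite addr_ge0 ?(ltW (dm0 _))// (le_trans ler01).
apply: (@le_trans _ _ (tau * inf [set dm m + Delta m | m in calM S t])%R).
  by rewrite ler_wpM2r// ler_piMl// ltW.
rewrite mulrCA ler_pM2l// -ler_pdivrMl//; apply: lb_le_inf.
  by exists (Num.max (dm m0) (Delta m0)), m0.
move=> _ [m Sm <-]; rewrite ler_pdivrMl//.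
apply: (@le_trans _ _ (dm m + Delta m)%R).
  apply: (@inf_le_mem _ 0%R); last by exists m.
  by move=> _ [m' _ <-]; rewrite addr_ge0 ?(ltW (dm0 _))// (le_trans ler01).
have : (dm m <= Num.max (dm m) (Delta m))%R by rewrite le_max lexx.
have : (Delta m <= Num.max (dm m) (Delta m))%R by rewrite le_max lexx orbT.
lra.
Qed.

End Penalty.

Theorem corollary2 (R : realType) (z : R)
    (hz : (0 < z < 1 - (Num.sqrt 2)^-1)%R) :
  exists (C : R) (C' : R -> R -> R), (0 < C)%R /\
  forall (k : nat) (d : 'I_k -> measure_display)
    (X : forall i, measurableType (d i)) (mu : mtuple R X)
    (d0 : measure_display) (Omega : measurableType d0)
    (P : probability Omega R) (N : randmeas R X Omega) (s : ktuple R X)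
    (L0 : set (ktuple R X))
    (M Lambda : countType) (S : M -> set (ktuple R X))
    (shat : Lambda -> Omega -> ktuple R X)
    (mhat : Lambda -> Omega -> M)
    (tau gamma Sigma : R) (Delta dm : M -> R)
    (pen : ktuple R X -> R) (lhat : Omega -> Lambda),
  (* the observation *)
  independent_randmeas P N ->
  (forall i, measurable_fun [set: X i] (s i) /\ forall x, (0 <= s i x)%R) ->
  (forall i (A : set (X i)), measurable A ->
     \int[P]_w N i w A = \int[mu i]_(x in A) (s i x)%:E /\
     \int[mu i]_(x in A) (s i x)%:E < +oo) ->
  L0 `<=` calL mu -> L0 s ->
  (* the models and the estimators *)
  (forall m, S m !=set0 /\ S m `<=` L0) ->
  (forall l, estimator mu N (shat l)) ->
  (forall l w, bbS S (shat l w)) ->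
  (forall l w, calM S (shat l w) (mhat l w)) ->
  (* the parameters *)
  (0 < tau)%R -> (0 < gamma)%R ->
  (forall m, (0 <= Delta m)%R) ->
  \esum_(m in [set: M]) (expR (- Delta m))%:E = Sigma%:E ->
  (forall m, (1 <= Delta m)%R) ->
  (forall m, (0 < dm m)%R) ->
  deviation_bound S P mu s N z tau gamma dm ->
  (* the penalty *)
  (forall t, bbS S t -> (0 <= pen t)%R) ->
  (forall t, bbS S t -> (pen_bound S z tau dm Delta t <= pen t)%R) ->
  (* the selection; no measurability of lhat is required, the integral of a
     nonnegative function being then its lower integral *)
  (forall w l,
     calD mu pen (obs N w) [set shat l' w | l' in [set: Lambda]]
       (shat (lhat w) w)
     <= calD mu pen (obs N w) [set shat l' w | l' in [set: Lambda]] (shat l w)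
        + tau%:E) ->
  let remainder := (tau * Num.max (gamma * Sigma ^+ 2) 1)%:E in
  [/\ C%:E * \int[P]_w hell2 mu s (shat (lhat w) w)
      <= \int[P]_w ereal_inf [set hell2 mu s (shat l w) + (pen (shat l w))%:E
                               | l in [set: Lambda]]
         + remainder,
      \int[P]_w ereal_inf [set hell2 mu s (shat l w) + (pen (shat l w))%:E
                            | l in [set: Lambda]]
         + remainder
      <= ereal_inf [set \int[P]_w (hell2 mu s (shat l w)
                                    + (pen (shat l w))%:E)
                     | l in [set: Lambda]]
         + remainder,
      (forall t, bbS S t -> pen t = pen_bound S z tau dm Delta t) ->
      \int[P]_w hell2 mu s (shat (lhat w) w)
      <= (C' gamma Sigma)%:E *
         ereal_inf [set \int[P]_w hell2 mu s (shat l w)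
                        + \int[P]_w (v2 S tau dm Delta (shat l w))%:E
                     | l in [set: Lambda]]
    & forall l w, (v2 S tau dm Delta (shat l w)
        <= tau * Num.max (dm (mhat l w)) (Delta (mhat l w)))%R].
Proof.
have /andP[z0 z1] := hz.
have zlt1 : (z < 1)%R by have := @inv_sqrt2_gt0 R; lra.
have A0 : (0 < selection_cst z)%R.
  by rewrite /selection_cst addr_gt0// divr_gt0// gap_gt0.
pose C := ((4 * selection_cst z)^-1)%R.
have C0 : (0 < C)%R by rewrite invr_gt0 mulr_gt0.
(* H^2 + pen is at most 2 (H^2 + v^2), whence 2; the remainder, at most
   max(gamma Sigma^2, 1) v^2 in mean, contributes the other term *)
exists C, (fun gamma Sigma => C^-1 * (2 + rem_cst gamma Sigma))%R; split=> //.
move=> k d X mu d0 Omega P N s L0 M Lambda S shat mhat tau gamma Sigma Delta dm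
  pen lhat _ mS NS L0L L0s SL0 est_shat bS_shat mhatP tau0 gamma0 D0 esD D1 dm0
  dev pen0 penL sel remainder.
have Ls : calL mu s by exact: L0L.
have SL m : S m `<=` calL mu by apply: subset_trans L0L; case: (SL0 m).
have Lshat l w : calL mu (shat l w) by case: (bS_shat l w) => m _ /SL.
pose K := rem_cst gamma Sigma.
have K1 : (1 <= K)%R by rewrite le_max lexx orbT.
have remE : remainder = (tau * K)%:E by [].
pose U w := hell2 mu s (shat (lhat w) w).
pose V w := ereal_inf [set hell2 mu s (shat l w) + (pen (shat l w))%:E | l in [set: Lambda]].
have H0 l w : 0 <= hell2 mu s (shat l w) by rewrite hell2_fin// lee_fin hell_ge0.
have HP0 l w : 0 <= hell2 mu s (shat l w) + (pen (shat l w))%:E.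
  by rewrite adde_ge0// lee_fin; exact/pen0/bS_shat.
have V0 w : 0 <= V w by apply: le_ereal_inf_tmp => _ [l _ <-].
have U0 w : 0 <= U w by exact: H0.
have [B HB] := bad_event_cover tau0 gamma0 D0 dm0 esD dev.
have mB n : measurable (B n) by case: (HB n).
have PB n : P (B n) <= (2 * K / (2 ^ n.+1)%:R)%:E by case: (HB n).
have aeN : {ae P, forall w, Tfinite (obs N w)}.
  apply: ae_Tfinite => i; have [-> ] := NS i setT measurableT; exact.
pose h w := (2 * tau)%:E + tau%:E * bad_count (R := R) B w.
have mcount : measurable_fun [set: Omega] (bad_count (R := R) B) := measurable_bad_count mB.
have count0 w := bad_count_ge0 (R := R) B w.
have h0 w : 0 <= h w by rewrite adde_ge0 ?mule_ge0 ?lee_fin ?mulr_ge0 ?(ltW tau0).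
have mh : measurable_fun [set: Omega] h.
  by apply: emeasurable_funD => //; apply: emeasurable_funM.
have pointwise : {ae P, forall w, (selection_cst z)^-1%:E * U w <= V w + h w}.
  apply: filterS aeN => w fNw.
  have [[n nBn]|allB] := pselect (exists n, ~ B n w); last first.
    (* every bad event occurs: the count is infinite and the bound is trivial *)
    have -> : h w = +oo.
      rewrite /h (_ : bad_count B w = +oo) ?gt0_muley ?lte_fin ?addey//.
      apply: eq_infty => r; apply: (@le_trans _ _ (Num.bound `|r|%R)%:R%:E).
        by rewrite lee_fin (le_trans (ler_norm r))// ltW// archi_boundP.
      apply: bad_count_ge => i _; apply: contrapT => nBi; apply: allB; by exists i.
    by rewrite addey ?leey// gt_eqF// (lt_le_trans _ (V0 w))// ltNy0.
  (* otherwise the observation is favourable at the first level n + 1 that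
     avoids B, and n is at most the count *)
  have exn : exists n, w \notin B n by exists n; rewrite notin_setE.
  case: (ex_minnP exn) => {nBn}n /negP; rewrite in_setE => nBn nmin.
  have Gn : n%:R%:E <= bad_count B w :> \bar R.
    apply: bad_count_ge => i ilt; apply: contrapT => nBi.
    by have := nmin i; rewrite notin_setE leqNgt ilt => /(_ nBi).
  have good : good_obs mu (obs N w) s S z tau n.+1%:R Delta dm.
    by apply: contrapT => bad; case: (HB n) => _ /(_ w bad) /nBn.
  apply: (@le_trans _ _ (V w + (tau * (n.+1%:R + 1))%:E)); last first.
    apply: leeD2l; apply: (@le_trans _ _ ((2 * tau)%:E + tau%:E * n%:R%:E)).
      by rewrite -EFinM -EFinD lee_fin -natr1; lra.
    by apply: leeD2l; rewrite lee_pmul2l.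
  rewrite -leeBlDr//; apply: le_ereal_inf_tmp => _ [l _ <-].
  rewrite leeBlDr// /U !hell2_fin// -EFinM -!EFinD lee_fin ler_pdivrMl//.
  apply: (selection_bound (F := [set shat l2 w | l2 in [set: Lambda]])
    z0 z1 tau0 _ D0 dm0 fNw Ls SL pen0 penL _ good).
  - by rewrite ltr0n.
  - by move=> _ [l2 _ <-].
  - by exists (lhat w).
  - by exists l.
  - exact: sel.
have inth : \int[P]_w h w <= (4 * K * tau)%:E.
  rewrite ge0_integralD//; last 3 first.
  - by move=> w _; rewrite lee_fin mulr_ge0// ltW.
  - by move=> w _; rewrite mule_ge0// lee_fin ltW.
  - exact: emeasurable_funM.
  rewrite integral_cst_probability ge0_integralZl_EFin ?(ltW tau0)//.
  apply: (@le_trans _ _ ((2 * tau)%:E + tau%:E * (2 * K)%:E)).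
    by apply: leeD2l; rewrite lee_pmul2l//; exact: integral_bad_count.
  by rewrite -EFinM -EFinD lee_fin; nra.
have ineq1 : C%:E * \int[P]_w U w <= \int[P]_w V w + remainder.
  have intV0 : 0 <= \int[P]_w V w by exact: integral_ge0.
  have := lower_integral_le_add (c := (selection_cst z)^-1) _ U0 V0 h0 mh pointwise.
  rewrite invr_gt0 => /(_ A0) main.
  have {}main := le_trans main (leeD2l _ inth).
  (* the factor 1/4 in C brings the remainder 4 K tau down to K tau *)
  rewrite /C invfM EFinM -muleA.
  apply: (@le_trans _ _ ((4^-1)%:E * (\int[P]_w V w + (4 * K * tau)%:E))).
    by rewrite lee_pmul2l// lte_fin invr_gt0.
  rewrite remE; case: (\int[P]_w V w) intV0 => [v| |] //.
  - by rewrite lee_fin => v0; rewrite -!EFinD -EFinM lee_fin; lra.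
  - by move=> _; rewrite addye// leey.
have ineq2 l : \int[P]_w V w <= \int[P]_w (hell2 mu s (shat l w) + (pen (shat l w))%:E).
  by apply: le_lower_integral => // w; apply: ereal_inf_lbound; exists l.
split => //.
- apply: leeD2r; apply: le_ereal_inf_tmp => _ [l _ <-]; exact: ineq2.
- move=> penE.
  have C'0 : (0 < C^-1 * (2 + rem_cst gamma Sigma))%R.
    by rewrite mulr_gt0 ?invr_gt0//; rewrite -/K; lra.
  rewrite -lee_pdivrMl//; apply: le_ereal_inf_tmp => _ [l _ <-].
  rewrite lee_pdivrMl//.
  set H := \int[P]_w hell2 mu s (shat l w).
  set v := \int[P]_w (v2 S tau dm Delta (shat l w))%:E.
  have v20 w : 0 <= (v2 S tau dm Delta (shat l w))%:E.
    by rewrite lee_fin (le_trans (ltW tau0))//; exact: (tau_le_v2 dm tau0 D1 (bS_shat l w)).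
  have Hge0 : 0 <= H by exact: integral_ge0.
  have tauv : tau%:E <= v.
    rewrite -[leLHS](integral_cst_probability P).
    apply: le_lower_integral => w; rewrite lee_fin; first exact: ltW.
    exact: (tau_le_v2 dm tau0 D1 (bS_shat l w)).
  have ineq3 : (2^-1)%:E * \int[P]_w (hell2 mu s (shat l w) + (pen (shat l w))%:E) <= v + H.
    (* here v^2 is the possibly nonmeasurable part and the loss the measurable
       one *)
    apply: lower_integral_le_add => //.
    - exact: (measurable_estimator_loss (est_shat l)).
    - apply: aeW => w; rewrite hell2_fin// penE// -EFinD -EFinM -EFinD lee_fin.
      have := pen_bound_le_v2 zlt1 tau0 D1 dm0 (bS_shat l w).
      have := hell_ge0 mu s (shat l w); lra.
  have ineq4 : C%:E * \int[P]_w U w <= 2%:E * (v + H) + remainder.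
    apply: le_trans ineq1 _; apply: leeD2r; apply: le_trans (ineq2 l) _.
    by rewrite -lee_pdivrMl.
  rewrite EFinM -muleA lee_pdivlMl//.
  apply: le_trans ineq4 _.
  case: H v Hge0 tauv {ineq3 v20} => [H| |] // [v| |] //.
  + rewrite remE !lee_fin => HH vv. rewrite -/K; nra.
  + by move=> _ _; rewrite [in leRHS]addey// [leRHS]gt0_muley ?leey// lte_fin -/K; lra.
  + by move=> _ _; rewrite [in leRHS]addye// [leRHS]gt0_muley ?leey// lte_fin -/K; lra.
  + by move=> _ _; rewrite [in leRHS]addye// [leRHS]gt0_muley ?leey// lte_fin -/K; lra.
- by move=> l w; apply: v2_le_model.
Qed.
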